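(* Every evil-avoiding permutation $\pi$ can be written uniquely as $\pi=\psi_{x_m}\circ\cdots\circ\psi_{x_1}(e_0)$ with $m\ge0$ and $x_1,\dots,x_m\in\{p,q,r,s\}$, where each operator $\psi_{x_j}$ is applied to a permutation in its domain.
   Context: Permutations $\pi\in S_n$ are written in one-line form; $e_n$ is the identity of $S_n$ and $e_0$ the empty permutation. A permutation is evil-avoiding if it avoids $2413,4132,4213,3214$. A recoil of $\pi\in S_n$ is $i\in\{1,\dots,n-1\}$ with $\pi^{-1}_i>\pi^{-1}_{i+1}$. For $\pi\in S_n$ and $1\le i,j\le n+1$, $\rho_{i,j}(\pi)\in S_{n+1}$ is obtained by increasing by $1$ every entry $\ge i$ and inserting value $i$ at position $j$; for $a>b$, $\gamma_{a,b}(\pi)$ removes the entry at position $a$ and reinserts it at position $b$. For $a\ge0$, $b\ge1$, $\pi\in S_n$ is $(a,b)$-sandwiched if $(\pi_1,\dots,\pi_a)=(1,\dots,a)$ and $(\pi_{n-b+1},\dots,\pi_n)=(a+1,\dots,a+b)$. Operators: $\psi_p=\rho_{1,1}$, domain non-identity evil-avoiding permutations; $\psi_q$, domain non-identity evil-avoiding permutations, with $\psi_q(\pi)=\gamma_{n-b+2,a+2}(\rho_{t+1,1}(\pi))$ if $\pi\in S_n$ is $(a,b)$-sandwiched and $\psi_q(\pi)=\rho_{t+1,1}(\pi)$ otherwise, where $t$ is the smallest recoil of $\pi$; $\psi_r(\pi)=\rho_{1,n+1}(\pi)$, domain evil-avoiding $\pi\in S_n$, $n\ge1$; $\psi_s(\pi)=\rho_{\pi_n+1,n+1}(\pi)$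 for $n\ge1$ and $\psi_s(e_0)=[1]$, with domain the evil-avoiding $\pi\in S_n$ ($n\ge0$) that are either $e_n$ or satisfy $(\pi_{n-t+1},\dots,\pi_n)=(1,\dots,t)$ for some $t\ge1$. *)

(* Defs.v *)
(* Permutations are seq nat in one-line form,
   with entries 1..n; positions are 1-based in the informal text. *)
From mathcomp Require Import all_boot.
Set Implicit Arguments. Unset Strict Implicit. Unset Printing Implicit Defensive.

Definition is_perm (s : seq nat) : bool := perm_eq s (iota 1 (size s)).

Definition is_id (s : seq nat) : bool := s == iota 1 (size s).

Definition order_iso (t p : seq nat) : Prop :=
  size t = size p /\
  forall i j, i < size p -> j < size p ->
    (nth 0 t i < nth 0 t j) = (nth 0 p i < nth 0 p j).

Definition contains (s p : seq nat) : Prop :=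
  exists t, subseq t s /\ order_iso t p.

Definition avoids (s p : seq nat) : Prop := ~ contains s p.

Definition evil_avoiding (s : seq nat) : Prop :=
  is_perm s /\ avoids s [:: 2; 4; 1; 3] /\ avoids s [:: 4; 1; 3; 2]
  /\ avoids s [:: 4; 2; 1; 3] /\ avoids s [:: 3; 2; 1; 4].

Definition is_recoil (s : seq nat) (i : nat) : bool :=
  (1 <= i <= (size s).-1) && (index i.+1 s < index i s).

(* smallest recoil (meaningful for non-identity permutations) *)
Definition smallest_recoil (s : seq nat) : nat :=
  head 0 [seq i <- iota 1 (size s).-1 | is_recoil s i].

Definition rho (i j : nat) (s : seq nat) : seq nat :=
  let s' := [seq (if i <= x then x.+1 else x) | x <- s] in
  take j.-1 s' ++ i :: drop j.-1 s'.

Definition gamma (a b : nat) (s : seq nat) : seq nat :=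
  let x := nth 0 s a.-1 in
  let s' := take a.-1 s ++ drop a s in
  take b.-1 s' ++ x :: drop b.-1 s'.

Definition sandwiched (a b : nat) (s : seq nat) : bool :=
  (1 <= b) && (take a s == iota 1 a) && (drop (size s - b) s == iota a.+1 b).

Inductive op := opP | opQ | opR | opS.

(* the (a,b) pairs for which s is sandwiched (at most one for non-identity s) *)
Definition sandwich_pairs (s : seq nat) : seq (nat * nat) :=
  [seq ab <- [seq (a, b) | a <- iota 0 (size s).+1, b <- iota 1 (size s)]
     | sandwiched ab.1 ab.2 s].

Definition psi_q (s : seq nat) : seq nat :=
  let n := size s in
  let t := smallest_recoil s in
  match sandwich_pairs s with
  | (a, b) :: _ => gamma (n - b + 2) (a + 2) (rho t.+1 1 s)
  | [::] => rho t.+1 1 s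
  end.

Definition psi_s (s : seq nat) : seq nat :=
  if s is [::] then [:: 1] else rho (last 0 s).+1 (size s).+1 s.

Definition psi (x : op) (s : seq nat) : seq nat :=
  match x with
  | opP => rho 1 1 s
  | opQ => psi_q s
  | opR => rho 1 (size s).+1 s
  | opS => psi_s s
  end.

Definition dom (x : op) (s : seq nat) : Prop :=
  match x with
  | opP => evil_avoiding s /\ ~~ is_id s
  | opQ => evil_avoiding s /\ ~~ is_id s
  | opR => evil_avoiding s /\ 1 <= size s
  | opS => evil_avoiding s /\
           (is_id s \/ exists t, 1 <= t /\ drop (size s - t) s = iota 1 t /\ t <= size s)
  end.

Fixpoint chain_ok (s : seq nat) (w : seq op) : Prop :=
  match w with
  | [::] => True
  | x :: w' => dom x s /\ chain_ok (psi x s) w'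
  end.

Definition run (w : seq op) : seq nat := foldl (fun s x => psi x s) [::] w.

(* Main.v *)
Require Import Defs.
From mathcomp Require Import all_boot zify.
Set Implicit Arguments. Unset Strict Implicit. Unset Printing Implicit Defensive.

(** A word is determined by its last letter and the permutation before it, so it is
    enough that every nonempty evil-avoiding [pi] has a unique predecessor. The last
    letter is read off from [pi]: it is [s] if [pi] is an identity or ends with
    [1, ..., t] for some [t >= 2], [r] if [pi] ends with [1] after a larger entry,
    [p] if [pi] starts with [1] and is not an identity, and [q] otherwise. In the last
    case let [v > 1] be the first entry: avoidance forces [1, ..., v - 1] to appear in
    increasing order. Deleting [v] gives the predecessor, unless this yields
    [1, ..., a + 1, tau, a + 2, ..., v - 1] with [tau] nonempty; the predecessor is then
    the sandwiched permutation [1, ..., a, tau, a + 1, ..., v - 1]. *)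

Implicit Types (s l m r tau : seq nat) (a b i j k n t v x : nat).

(* [lia] does not identify [size] at [nat] with [size] at its [eqType] structure. *)
Ltac slia :=
  change (Equality.sort Datatypes_nat__canonical__eqtype_Equality) with nat in *; lia.

(** * Patterns as inequalities between four entries *)

(** The disjuncts are, in order, the patterns 2413, 4132, 4213 and 3214. *)
Definition evil (w x y z : nat) : bool :=
  [|| [&& y < w, w < z & z < x], [&& x < z, z < y & y < w],
      [&& y < x, x < z & z < w] | [&& y < x, x < w & w < z]].

Lemma avoids4P (s : seq nat) (p0 p1 p2 p3 : nat) :
  avoids s [:: p0; p1; p2; p3] <->
  forall w x y z, subseq [:: w; x; y; z] s ->
    ~ order_iso [:: w; x; y; z] [:: p0; p1; p2; p3].
Proof.
split=> [av w x y z sub iso|av [t [sub iso]]]; first by apply: av; exists [:: w; x; y; z].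
case: (iso) => szt _.
by case: t szt sub iso => [|w [|x [|y [|z []]]]] // _; apply: av.
Qed.

(** Both comparisons of each pair are listed because the four entries are not assumed distinct; in
    this form [lia] can relate the result to [evil]. *)
Lemma order_iso4 (w x y z p0 p1 p2 p3 : nat) :
  order_iso [:: w; x; y; z] [:: p0; p1; p2; p3] <->
  [&& (w < x) == (p0 < p1), (w < y) == (p0 < p2), (w < z) == (p0 < p3),
      (x < y) == (p1 < p2), (x < z) == (p1 < p3) & (y < z) == (p2 < p3)] /\
  [&& (x < w) == (p1 < p0), (y < w) == (p2 < p0), (z < w) == (p3 < p0),
      (y < x) == (p2 < p1), (z < x) == (p3 < p1) & (z < y) == (p3 < p2)].
Proof.
split=> [[_ iso]|[]].
  have e i j : i < 4 -> j < 4 -> _ := iso i j.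
  by rewrite (e 0 1) // (e 0 2) // (e 0 3) // (e 1 2) // (e 1 3) // (e 2 3) //
    (e 1 0) // (e 2 0) // (e 3 0) // (e 2 1) // (e 3 1) // (e 3 2) // !eqxx.
move=> /and5P[/eqP ? /eqP ? /eqP ? /eqP ? /andP[/eqP ? /eqP ?]].
move=> /and5P[/eqP ? /eqP ? /eqP ? /eqP ? /andP[/eqP ? /eqP ?]].
by split=> // -[|[|[|[|i]]]] [|[|[|[|j]]]] //= _ _; rewrite ?ltnn.
Qed.

Lemma evil_avoidingP (s : seq nat) :
  evil_avoiding s <->
  is_perm s /\ forall w x y z, subseq [:: w; x; y; z] s -> ~~ evil w x y z.
Proof.
rewrite /evil_avoiding !avoids4P; split.
  move=> [ps [h1 [h2 [h3 h4]]]]; split=> // w x y z sub; apply/negP => ev.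
  by move: (h1 _ _ _ _ sub) (h2 _ _ _ _ sub) (h3 _ _ _ _ sub) (h4 _ _ _ _ sub);
    rewrite !order_iso4; move: ev; rewrite /evil; lia.
move=> [ps h]; split=> //.
by do ![split]; move=> w x y z /h ev; rewrite order_iso4; move: ev; rewrite /evil; lia.
Qed.

(** * Deleting and inserting a value *)

Lemma subseq_mapP (T1 T2 : eqType) (f : T1 -> T2) (t : seq T2) (s : seq T1) :
  subseq t (map f s) -> exists2 t', subseq t' s & t = map f t'.
Proof.
move=> /subseqP[m szm ->]; exists (mask m s); first exact: mask_subseq.
by rewrite map_mask.
Qed.

Lemma is_permP s : is_perm s <-> uniq s /\ forall x, (x \in s) = (1 <= x <= size s).
Proof.
rewrite /is_perm; split=> [ps|[us ms]].
  split; first by rewrite (perm_uniq ps) iota_uniq.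
  by move=> x; rewrite (perm_mem ps) mem_iota; lia.
by apply: uniq_perm; rewrite ?iota_uniq// => x; rewrite ms mem_iota; lia.
Qed.

(** Deletion is by value, not by position, so that one function undoes [rho v j] for every [j]. *)
Definition del (v : nat) (s : seq nat) : seq nat :=
  [seq (if v < x then x.-1 else x) | x <- [seq x <- s | x != v]].

Lemma perm_eq_del (v : nat) (s : seq nat) : perm_eq s (v :: [seq x <- s | x != v]) ->
  1 <= v -> is_perm s -> is_perm (del v s).
Proof.
move=> ps v1 /is_permP[us ms]; apply/is_permP.
have sz : size s = (size (del v s)).+1 by rewrite (perm_size ps) /= size_map.
have vs : v \in s by rewrite (perm_mem ps) mem_head.
move: (ms v); rewrite vs => /esym v2.
split.
  rewrite map_inj_in_uniq ?filter_uniq// => x y.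
  rewrite !mem_filter /= => /andP[xv _] /andP[yv _].
  by case: (ltnP v x); case: (ltnP v y); lia.
move=> x; apply/mapP/idP => [[y]|xs].
  by rewrite mem_filter ms /= => /andP[yv ys] ->; case: (ltnP v y); lia.
exists (if v <= x then x.+1 else x); last first.
  by case: (leqP v x) => ?; [case: (ltnP v x.+1)|case: (ltnP v x)]; lia.
by rewrite mem_filter ms /=; case: (leqP v x); lia.
Qed.

Lemma perm_filterC1 (v : nat) s : uniq s -> v \in s -> perm_eq s (v :: [seq x <- s | x != v]).
Proof.
move=> us vs; apply: uniq_perm => //=; first by rewrite mem_filter eqxx filter_uniq.
by move=> x; rewrite inE mem_filter; case: eqVneq => // ->.
Qed.

Lemma is_perm_del v s : v \in s -> is_perm s -> is_perm (del v s).
Proof.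
move=> vs ps; have [us ms] := (is_permP s).1 ps.
apply: perm_eq_del => //; first exact: perm_filterC1.
by move: vs; rewrite ms => /andP[].
Qed.

(** Lowering the entries above [v] keeps the order among entries other than [v], so a pattern in
    [del v s] lifts to the same pattern in [s]. *)
Lemma evil_avoiding_del v s : v \in s -> evil_avoiding s -> evil_avoiding (del v s).
Proof.
move=> vs /evil_avoidingP[ps ev]; apply/evil_avoidingP; split; first exact: is_perm_del.
move=> w x y z /subseq_mapP[[|w' [|x' [|y' [|z' []]]]] sub] // [-> -> -> ->].
have nv u : u \in [:: w'; x'; y'; z'] -> u != v.
  by move=> /(mem_subseq sub); rewrite mem_filter => /andP[].
have := ev _ _ _ _ (subseq_trans sub (filter_subseq _ _)).
have := nv w'; have := nv x'; have := nv y'; have := nv z'.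
rewrite !inE !eqxx !orbT /= => /(_ isT) ? /(_ isT) ? /(_ isT) ? /(_ isT) ?.
rewrite /evil; case: (ltnP v w') => ?; case: (ltnP v x') => ?;
  by case: (ltnP v y') => ?; case: (ltnP v z') => ?; lia.
Qed.

(** The shift leaves a gap at [v], so the filter removes exactly the inserted entry. Hence insertion
    is injective once the inserted value is known. *)
Lemma rhoK v j s : del v (rho v j s) = s.
Proof.
rewrite /rho /del; set s' := map _ s.
have vs' : all (fun x => x != v) s'.
  by apply/allP => _ /mapP[x _ ->]; case: (leqP v x); lia.
rewrite filter_cat /= eqxx /= -filter_cat cat_take_drop (all_filterP vs') -map_comp.
apply: map_id_in => x _ /=.
by case: (leqP v x) => ?; [case: (ltnP v x.+1)|case: (ltnP v x)]; lia.
Qed.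

Lemma rho_del v l1 l2 : uniq (l1 ++ v :: l2) ->
  rho v (size l1).+1 (del v (l1 ++ v :: l2)) = l1 ++ v :: l2.
Proof.
rewrite cat_uniq /= => /and4P[ul1 /norP[vl1 _] vl2 ul2].
rewrite /rho /del filter_cat /= eqxx /= -filter_cat.
have /all_filterP -> : all (fun x => x != v) (l1 ++ l2).
  apply/allP => x; rewrite mem_cat; apply: contraTneq => ->.
  by rewrite (negPf vl1) (negPf vl2).
rewrite -map_comp map_id_in ?take_size_cat ?drop_size_cat// => x xl.
have : x != v.
  by apply: contraTneq xl => ->; rewrite mem_cat (negPf vl1) (negPf vl2).
by rewrite /=; case: (ltnP v x) => ?; [case: (leqP v x.-1)|case: (leqP v x)]; lia.
Qed.

Lemma size_rho v j s : size (rho v j s) = (size s).+1.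
Proof. by rewrite /rho size_cat /= addnS -size_cat cat_take_drop size_map. Qed.

Lemma rho1 v s : rho v 1 s = v :: [seq (if v <= x then x.+1 else x) | x <- s].
Proof. by rewrite /rho take0 drop0. Qed.

Lemma rho_rcons v s :
  rho v (size s).+1 s = rcons [seq (if v <= x then x.+1 else x) | x <- s] v.
Proof. by rewrite /rho /= take_oversize ?drop_oversize ?size_map// cats1. Qed.

(** * Recoils *)

(** Without a recoil below [k], the values [1, ..., k] occur at increasing positions. Both lists are
    then sorted by position in [s] and have the same elements. *)
Lemma filter_le_iota s k : is_perm s -> k <= size s ->
  (forall i, i < k -> ~~ is_recoil s i) -> [seq x <- s | x <= k] = iota 1 k.
Proof.
move=> /is_permP[us ms] ks nr.
pose r (x y : nat) : bool := index x s <= index y s.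
have rtr : transitive r by move=> y x z; rewrite /r; slia.
apply: (@sorted_eq_in _ r).
- by move=> x y z _ _ _; apply: rtr.
- move=> x y; rewrite !mem_filter => /andP[_ xs] /andP[_ ys] rxy.
  have e : index x s = index y s by move: rxy; rewrite /r; slia.
  by rewrite -(nth_index 0 xs) e nth_index.
- apply: sorted_filter => //; apply/(sortedP 0) => i ilt.
  by rewrite /r !index_uniq ?(ltnW ilt).
- apply/(sortedP 0) => i; rewrite size_iota => ik; rewrite /r !nth_iota; [|slia..].
  have := nr (i.+1); rewrite /is_recoil !add1n leqNgt => /(_ ltac:(slia)); slia.
- apply: uniq_perm; rewrite ?iota_uniq ?filter_uniq// => x.
  by rewrite mem_filter ms mem_iota; slia.
Qed.

Definition first_recoil s t := is_recoil s t /\ forall i, i < t -> ~~ is_recoil s i.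

Lemma smallest_recoilE s t : first_recoil s t -> smallest_recoil s = t.
Proof.
move=> [rt mt]; rewrite /smallest_recoil.
have [t1 t2] : 1 <= t /\ t <= (size s).-1 by case/andP: rt => /andP.
have -> : (size s).-1 = t.-1 + ((size s).-1 - t).+1 by slia.
rewrite iotaD filter_cat.
have -> : [seq i <- iota 1 t.-1 | is_recoil s i] = [::].
  apply/eqP; rewrite -[_ == _]negbK -has_filter; apply/hasPn => i.
  by rewrite mem_iota => it; apply: mt; slia.
by rewrite /= add1n prednK// rt.
Qed.

(** With no recoil at all, [filter_le_iota] for [k = size s] would make [s] the identity. *)
Lemma smallest_recoilP s : is_perm s -> ~~ is_id s -> first_recoil s (smallest_recoil s).
Proof.
move=> ps nid.
have ex : exists i, is_recoil s i.
  have [/hasP[i _ ri]|/hasPn h] := boolP (has (is_recoil s) (iota 1 (size s))).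
    by exists i.
  case/negP: nid; rewrite /is_id -(filter_le_iota ps (leqnn _)); last first.
    move=> i ilt; have [i0|i0] := posnP i; first by rewrite i0.
    by apply: h; rewrite mem_iota; slia.
  apply/eqP/esym/all_filterP/allP => x.
  by case/is_permP: ps => _ -> /andP[].
have fr : first_recoil s (ex_minn ex).
  case: ex_minnP => t rt mt; split=> // i it.
  by apply/negP => /mt; slia.
by rewrite (smallest_recoilE fr).
Qed.

(** * Sandwiched permutations and [psi_q] *)

Lemma iota1S n : iota 1 n.+1 = rcons (iota 1 n) n.+1.
Proof. by rewrite -(addn1 n) iotaD cats1 add1n addn1. Qed.

(** The last block may be empty: [b = 0] arises when [psi_q] moves the only entry of that block to
    the end of the first one. *)
Definition sandwich a tau b := iota 1 a ++ tau ++ iota a.+1 b.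

Lemma size_sandwich a tau b : size (sandwich a tau b) = a + size tau + b.
Proof. by rewrite /sandwich !size_cat !size_iota addnA. Qed.

Lemma mem_sandwich a tau b x : is_perm (sandwich a tau b) ->
  (x \in tau) = (a + b < x <= a + size tau + b).
Proof.
move=> /is_permP[]; rewrite size_sandwich /sandwich !cat_uniq.
move=> /and3P[_ h1 /and3P[_ h2 _]] /(_ x); rewrite !mem_cat.
have {}h1 : x \in tau -> x \notin iota 1 a.
  by move=> xt; apply/negP => xa; case/hasP: h1; exists x; rewrite ?mem_cat ?xt.
have {}h2 : x \in tau -> x \notin iota a.+1 b.
  by move=> xt; apply/negP => xa; case/hasP: h2; exists x; rewrite ?mem_cat ?xt.
move: h1 h2; rewrite !mem_iota; case: (x \in tau); slia.
Qed.

Lemma sandwichedP s a b : is_perm s -> ~~ is_id s ->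
  reflect (1 <= b /\ exists2 tau, tau <> [::] & s = sandwich a tau b)
          (sandwiched a b s).
Proof.
move=> ps nid; have [us ms] := (is_permP s).1 ps; apply: (iffP idP); last first.
  move=> [b1 [tau _ ->]]; rewrite /sandwiched b1 size_sandwich addnK.
  rewrite /sandwich take_size_cat ?size_iota// catA drop_size_cat ?eqxx//.
  by rewrite size_cat size_iota.
move=> /andP[/andP[b1 /eqP ta0] /eqP db0]; split=> //.
have {ta0} ta : take a s = iota 1 a := ta0.
have {db0} db : drop (size s - b) s = iota a.+1 b := db0.
have as_ : a <= size s.
  by have := congr1 size ta; rewrite size_take size_iota; case: (ltnP a (size s)); slia.
have bs : b <= size s.
  by have := congr1 size db; rewrite size_drop size_iota; slia.
have nb : nth 0 s (size s - b) = a.+1.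
  by rewrite -[size s - b]addn0 -nth_drop db nth_iota// addn0.
(* Overlapping blocks would put two values at one position, and blocks that just touch would make
   [s] the identity. *)
have lt_ab : a < size s - b.
  rewrite ltnNge; apply/negP => ba.
  have e : a = size s - b.
    apply/eqP; rewrite eqn_leq ba andbT leqNgt; apply/negP => lt.
    have := nth_take 0 lt s; rewrite ta nth_iota// nb; slia.
  case/negP: nid; rewrite /is_id -{1}(cat_take_drop a s) ta.
  have -> : drop a s = iota (1 + a) b by rewrite {1}e db.
  by rewrite -iotaD; apply/eqP; congr (iota 1 _); slia.
exists (drop a (take (size s - b) s)).
  move=> /(congr1 size); rewrite size_drop size_take.
  by case: (ltnP (size s - b) (size s)) => /=; slia.
rewrite /sandwich -ta -db -{1}(cat_take_drop (size s - b) s) catA; congr (_ ++ _).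
by rewrite -{1}(cat_take_drop a (take _ _)) take_takel// ltnW.
Qed.

(** The values [1, ..., a + b] occur in increasing order and [a + b] is in the last block, whereas
    [a + b + 1] lies in [tau] and so precedes it. *)
Lemma first_recoil_sandwich a b tau : is_perm (sandwich a tau b) -> tau <> [::] ->
  1 <= b -> first_recoil (sandwich a tau b) (a + b).
Proof.
move=> ps tau0 b1; have mt := fun x => mem_sandwich x ps.
have szt : 0 < size tau by rewrite lt0n; apply/negP => /nilP.
have ia i : 1 <= i <= a -> index i (sandwich a tau b) = i.-1.
  move=> ia; rewrite /sandwich index_cat mem_iota.
  rewrite [_ && _](_ : _ = true); last by slia.
  rewrite -[i in index i _](_ : nth 0 (iota 1 a) i.-1 = i) ?index_uniq
     ?iota_uniq ?size_iota ?nth_iota; slia.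
have ib i : a < i <= a + b -> index i (sandwich a tau b) = (i + size tau).-1.
  move=> ib; rewrite /sandwich !index_cat mem_iota mt !size_iota.
  rewrite [_ && _](_ : _ = false); last by slia.
  rewrite [_ && _](_ : _ = false); last by slia.
  have e : nth 0 (iota a.+1 b) (i - a.+1) = i by rewrite nth_iota; slia.
  by rewrite -[i in index i _]e index_uniq ?iota_uniq ?size_iota//; slia.
split.
  rewrite /is_recoil size_sandwich (ib (a + b)); last by slia.
  have lt : index (a + b).+1 (sandwich a tau b) < a + size tau.
    rewrite /sandwich !index_cat mem_iota size_iota.
    rewrite [1 <= _ < _](_ : _ = false); last by slia.
    by rewrite mt [_ < _ <= _](_ : _ = true) ?ltn_add2l ?index_mem ?mt; slia.
  slia.
move=> i it; rewrite /is_recoil; have [->//|i0] := posnP i.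
have [ilt|ige] := ltnP i a; first by rewrite !ia; slia.
have [ea|ne] := eqVneq i a; first by rewrite (ia i) ?(ib i.+1); slia.
by rewrite !ib; slia.
Qed.

(** The number of entries before the first one above [t] is [a]; the size condition then gives [tau]
    and [tau'] the same length. *)
Lemma iota_prefix_inj t a a' tau tau' r r' : a <= t -> a' <= t ->
  tau <> [::] -> tau' <> [::] ->
  (forall x, x \in tau -> t < x) -> (forall x, x \in tau' -> t < x) ->
  size r + a = size r' + a' ->
  iota 1 a ++ tau ++ r = iota 1 a' ++ tau' ++ r' ->
  [/\ a = a', tau = tau' & r = r'].
Proof.
have fnd c (u w : seq nat) : c <= t -> u <> [::] -> (forall x, x \in u -> t < x) ->
    find (fun x => t < x) (iota 1 c ++ u ++ w) = c.
  case: u => // x u ct _ h; rewrite find_cat size_iota.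
  case: hasP => [[y]|_]; first by rewrite mem_iota; slia.
  by rewrite /= h ?mem_head ?addn0.
move=> la la' t0 t0' h h' sz e.
have ea : a = a' by rewrite -(fnd a tau r) // e fnd.
move: e sz; rewrite -ea => e sz.
have : iota 1 a ++ tau ++ r == iota 1 a ++ tau' ++ r' by rewrite e.
rewrite eqseq_cat// eqxx /= => /eqP e'.
have st : size tau = size tau' by have := congr1 size e'; rewrite !size_cat; slia.
by move/eqP: e'; rewrite eqseq_cat// => /andP[/eqP-> /eqP->].
Qed.

(** The smallest recoil of the common permutation is both [a + b] and [a' + b']; it serves as the
    threshold in [iota_prefix_inj]. *)
Lemma sandwich_inj a b tau a' b' tau' : is_perm (sandwich a tau b) ->
  tau <> [::] -> tau' <> [::] -> 1 <= b -> 1 <= b' ->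
  sandwich a tau b = sandwich a' tau' b' -> [/\ a = a', tau = tau' & b = b'].
Proof.
move=> ps t0 t0' b1 b1' e; have ps' := ps; rewrite e in ps'.
have eab : a + b = a' + b'.
  rewrite -(smallest_recoilE (first_recoil_sandwich ps t0 b1)) e.
  exact: smallest_recoilE (first_recoil_sandwich ps' t0' b1').
have [] := iota_prefix_inj (t := a + b) _ _ t0 t0' _ _ _ e.
- slia.
- slia.
- by move=> x; rewrite (mem_sandwich _ ps); slia.
- by move=> x; rewrite (mem_sandwich _ ps') eab; slia.
- by rewrite !size_iota; slia.
by move=> ea et _; split=> //; slia.
Qed.

Lemma gamma_cat l m x r :
  gamma (size (l ++ m)).+1 (size l).+1 (l ++ m ++ x :: r) = l ++ x :: m ++ r.
Proof.
rewrite /gamma /= (catA l m) nth_cat ltnn subnn /=.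
rewrite (@take_size_cat _ (size (l ++ m)))//.
have -> : drop (size (l ++ m)).+1 ((l ++ m) ++ x :: r) = r.
  by rewrite drop_cat ltnNge leqnSn subSnn /= drop0.
by rewrite -catA take_size_cat// drop_size_cat.
Qed.

(** Behind the new first entry, position [n - b + 2] (with [n] the size) holds [a + 1], the head of
    the last block; moving it to position [a + 2] appends it to [1, ..., a]. The shift in [rho]
    leaves both outer blocks unchanged. *)
Lemma gamma_sandwich a b tau : 1 <= b ->
  gamma (a + size tau + b - b + 2) (a + 2) (rho (a + b).+1 1 (sandwich a tau b)) =
  rho (a + b).+1 1 (sandwich a.+1 tau b.-1).
Proof.
case: b => // b _; rewrite !rho1 addnK !addn2 /sandwich.
set f := fun x => _; rewrite !map_cat.
have fi i n : i + n <= (a + b.+1).+1 -> map f (iota i n) = iota i n.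
  move=> mn; apply: map_id_in => x; rewrite mem_iota /f => xi.
  by case: (ltnP (a + b.+1) x); slia.
rewrite !fi; try slia.
rewrite iota1S cat_rcons.
have := gamma_cat ((a + b.+1).+1 :: iota 1 a) (map f tau) a.+1 (iota a.+2 b).
by rewrite /= size_cat size_map !size_iota.
Qed.

Lemma psi_q_sandwich a b tau : is_perm (sandwich a tau b) ->
  ~~ is_id (sandwich a tau b) -> tau <> [::] -> 1 <= b ->
  psi_q (sandwich a tau b) = rho (a + b).+1 1 (sandwich a.+1 tau b.-1).
Proof.
move=> ps nid t0 b1; rewrite /psi_q (smallest_recoilE (first_recoil_sandwich ps t0 b1)).
case E: sandwich_pairs => [|[a' b'] l].
  have : (a, b) \in sandwich_pairs (sandwich a tau b).
    rewrite mem_filter; apply/andP; split.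
      by apply/(sandwichedP _ _ ps nid); split=> //; exists tau.
    by apply: allpairs_f; rewrite mem_iota size_sandwich; slia.
  by rewrite E.
(* [psi_q] uses the first pair listed; by [sandwich_inj] it can only be [(a, b)]. *)
have : (a', b') \in sandwich_pairs (sandwich a tau b) by rewrite E mem_head.
rewrite mem_filter => /andP[/(sandwichedP _ _ ps nid)[b1' [tau' t0' e]] _].
have /= [ea _ eb] := sandwich_inj ps t0 t0' b1 b1' e; rewrite -ea -eb.
by rewrite -gamma_sandwich// size_sandwich.
Qed.

Lemma psi_q_not_sandwich s : is_perm s -> ~~ is_id s ->
  (forall a b tau, 1 <= b -> tau <> [::] -> s <> sandwich a tau b) ->
  psi_q s = rho (smallest_recoil s).+1 1 s.
Proof.
move=> ps nid ns; rewrite /psi_q; case E: sandwich_pairs => [//|[a b] l].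
have : (a, b) \in sandwich_pairs s by rewrite E mem_head.
rewrite mem_filter => /andP[/(sandwichedP _ _ ps nid)[b1 [tau t0 e]] _].
by case: (ns a b tau).
Qed.

(** In both cases one more than the smallest recoil is inserted in front; only the permutation
    receiving it differs. *)
Lemma psi_qP s : is_perm s -> ~~ is_id s ->
  (exists a tau b, [/\ 1 <= b, tau <> [::], s = sandwich a tau b,
     smallest_recoil s = a + b &
     psi_q s = rho (a + b).+1 1 (sandwich a.+1 tau b.-1)]) \/
  (forall a b tau, 1 <= b -> tau <> [::] -> s <> sandwich a tau b) /\
  psi_q s = rho (smallest_recoil s).+1 1 s.
Proof.
move=> ps nid.
have [/hasP[[a b] _ /(sandwichedP _ _ ps nid)[b1 [tau t0 e]]]|/hasPn h] :=
  boolP (has (fun ab => sandwiched ab.1 ab.2 s)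
    [seq (a, b) | a <- iota 0 (size s).+1, b <- iota 1 (size s)]).
  left; exists a, tau, b; split=> //; rewrite e.
    by apply/smallest_recoilE/first_recoil_sandwich; rewrite -?e.
  by apply: psi_q_sandwich; rewrite -?e.
right; have ns a b tau : 1 <= b -> tau <> [::] -> s <> sandwich a tau b.
  move=> b1 t0 e; suff /h/negP[] :
      (a, b) \in [seq (a, b) | a <- iota 0 (size s).+1, b <- iota 1 (size s)].
    by apply/(sandwichedP _ _ ps nid); split=> //; exists tau.
  by apply: allpairs_f; rewrite mem_iota e size_sandwich; slia.
by split=> //; apply: psi_q_not_sandwich.
Qed.

(** * Reading the last operator off the image *)

Definition ends1 s := has (fun t => drop (size s - t) s == iota 1 t) (iota 1 (size s)).

Lemma ends1P s : reflect (exists l t, 1 <= t /\ s = l ++ iota 1 t) (ends1 s).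
Proof.
apply: (iffP hasP) => [[t]|[l [t [t1 ->]]]].
  rewrite mem_iota => ts /eqP dt.
  by exists (take (size s - t) s), t; rewrite -dt cat_take_drop; split=> //; slia.
exists t; first by rewrite mem_iota size_cat size_iota; slia.
by rewrite size_cat size_iota addnK drop_size_cat.
Qed.

Lemma last_iota k : last 0 (iota 1 k) = k.
Proof. by case: k => // k; rewrite iota1S last_rcons. Qed.

(** The shifted copy of [s] has no entry [v], so the final run stops below [v], where the shift
    changes nothing. *)
Lemma ends1_rho v s : ends1 (rho v 1 s) -> 1 < v ->
  exists l t, 1 <= t < v /\ s = l ++ iota 1 t.
Proof.
rewrite rho1 => /ends1P[[|y l] [t [t1]]].
  by case: t t1 => //= t _ [-> _].
move=> /= [_ e] v1; have tv : t < v.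
  rewrite ltnNge; apply/negP => vt.
  have : v \in l ++ iota 1 t by rewrite mem_cat mem_iota; apply/orP; right; slia.
  by rewrite -e => /mapP[x _]; case: (leqP v x); slia.
exists (take (size l) s), t; rewrite t1; split=> //.
rewrite -{1}(cat_take_drop (size l) s); congr (_ ++ _).
have := congr1 (drop (size l)) e; rewrite drop_size_cat// -map_drop => {}e.
apply: (inj_map (f := fun x => if v <= x then x.+1 else x)).
  by move=> x z; case: (leqP v x); case: (leqP v z); slia.
rewrite e -[LHS]map_id; apply/eq_in_map => x; rewrite mem_iota /=.
by case: (leqP v x); slia.
Qed.

Definition op_shape (x : op) s : Prop :=
  match x with
  | opP => head 0 s = 1 /\ ~~ is_id s
  | opQ => head 0 s <> 1 /\ ~~ ends1 s
  | opR => head 0 s <> 1 /\ last 0 s = 1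
  | opS => is_id s \/ [/\ head 0 s <> 1, last 0 s <> 1 & ends1 s]
  end.

Lemma is_id_head s : s <> [::] -> is_id s -> head 0 s = 1.
Proof. by case: s => // x s _ /eqP[]. Qed.

Lemma is_id_ends1 s : s <> [::] -> is_id s -> ends1 s.
Proof. by case: s => // x s _ /eqP ->; apply/ends1P; exists [::], (size s).+1. Qed.

Lemma last1_ends1 s : last 0 s = 1 -> ends1 s.
Proof.
by case/lastP: s => // s x; rewrite last_rcons => ->; apply/ends1P; exists s, 1; rewrite cats1.
Qed.

(** An identity starts with [1] and satisfies [ends1], and so does any word ending with [1] satisfy
    [ends1]; the rest is propositional. The empty word is excluded since it has the shapes of both
    [opQ] and [opS]. *)
Lemma op_shape_inj (x y : op) s : s <> [::] -> op_shape x s -> op_shape y s -> x = y.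
Proof.
move=> s0; have hd := is_id_head s0; have en := is_id_ends1 s0.
have la := @last1_ends1 s.
case: x; case: y => //=; move: hd en la; rewrite /is_true;
  case: (is_id s); case: (ends1 s) => /= hd en la;
  by firstorder congruence.
Qed.

Lemma size_psi (x : op) s : dom x s -> size (psi x s) = (size s).+1.
Proof.
case: x => /= [_|[/evil_avoidingP[ps _] nid]|_|_].
- by rewrite size_rho.
- have [[a [tau [b [b1 t0 es _ ->]]]]|[_ ->]] := psi_qP ps nid; rewrite size_rho//.
  by rewrite es !size_sandwich; slia.
- by rewrite size_rho.
- by case: s => // y s; rewrite /psi_s size_rho.
Qed.

Lemma rho11_id s : is_id (rho 1 1 s) -> is_id s.
Proof.
rewrite /is_id size_rho => /eqP e.
have h : rho 1 1 (iota 1 (size s)) = iota 1 (size s).+1.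
  rewrite rho1 /= -[iota 2 _]/(iota (1 + 1) _) iotaDl; congr (_ :: _).
  by apply/eq_in_map => x; rewrite mem_iota /= => /andP[-> _].
by rewrite -{1}(rhoK 1 1 s) e -h rhoK.
Qed.

Lemma psi_shape (x : op) s : dom x s -> op_shape x (psi x s).
Proof.
case: x => /=.
- move=> [_ nid]; split; first by rewrite rho1.
  by apply: contra nid => /rho11_id.
- move=> [/evil_avoidingP[ps _] nid].
  have [/andP[/andP[t1 tn] _] _] := smallest_recoilP ps nid.
  have [[a [tau [b [b1 t0 es ts e]]]]|[ns e]] := psi_qP ps nid.
    rewrite e; split; first by rewrite rho1 /=; slia.
    (* A final run [1, ..., k] would already end [sandwich a.+1 tau b.-1], which starts with [1]:
       either [tau] is empty or [1] occurs twice. *)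
    apply/negP => /ends1_rho/(_ ltac:(slia))[[|y l] [k [k1 ek]]].
      have := congr1 size ek; rewrite size_sandwich size_iota.
      by case: tau t0 {es e ek} => //= y tau _; slia.
    move: ps ek; rewrite es /sandwich /= => ps -[_ ek].
    have : 1 \in l ++ iota 1 k by rewrite mem_cat mem_iota orbC; slia.
    by rewrite -ek !mem_cat !mem_iota (mem_sandwich 1 ps); slia.
  rewrite e; split; first by rewrite rho1 /=; slia.
  apply/negP => /ends1_rho/(_ ltac:(slia))[l [k [/andP[k1 _] es]]].
  (* Ending with [1, ..., k] is being sandwiched with an empty first block. *)
  case: (ns 0 k l) => //.
  by move=> l0; case/negP: nid; rewrite es l0 /is_id size_iota.
- move=> [ev s1]; rewrite rho_rcons last_rcons; split=> //.
  by case: s s1 {ev} => //= y s _; case: y.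
- move=> [/evil_avoidingP[/is_permP[us ms] _]].
  case: s us ms => [|y s] us ms; first by left.
  rewrite /psi_s; set s' := y :: s; have [ids _|nid [//|[t [t1 [dt ts]]]]] := boolP (is_id s').
    left; rewrite /is_id size_rho rho_rcons (eqP ids) last_iota size_iota.
    rewrite map_id_in; first by rewrite iota1S.
    by move=> x; rewrite mem_iota; case: (leqP (size s').+1 x); slia.
  right; have es : s' = take (size s' - t) s' ++ iota 1 t by rewrite -dt cat_take_drop.
  have ls : last 0 s' = t by rewrite es last_cat; case: (t) t1 => // k _; exact: (last_iota k.+1).
  rewrite ls rho_rcons last_rcons; split; [|slia|].
    (* A leading [1] would be repeated in the final run, unless that run is all of [s'], which is
       not an identity. *)
    have y1 : y <> 1.
      move=> y1; case/negP: nid; move: us es; rewrite -/s'.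
      case E: (take _ _) => [|z r]; first by move=> _ ->; rewrite /is_id size_iota.
      move=> + es; rewrite es; move: es; rewrite /s' y1 => -[<- _] /=.
      by rewrite mem_cat mem_iota; slia.
    by rewrite /=; case: ifP; slia.
  apply/ends1P; exists (map (fun x => if t < x then x.+1 else x) (take (size s' - t) s')), t.+1.
  split=> //; rewrite {1}es map_cat iota1S -rcons_cat; congr (rcons (_ ++ _) _).
  by apply: map_id_in => x; rewrite mem_iota; case: (leqP t.+1 x); slia.
Qed.

(** * Injectivity of the operators *)

Lemma rho1_inj v v' s s' : rho v 1 s = rho v' 1 s' -> v = v' /\ s = s'.
Proof.
move=> e; have ev : v = v' by have := congr1 (head 0) e; rewrite !rho1.
by split=> //; rewrite -(rhoK v 1 s) e ev rhoK.
Qed.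

Lemma psi_q_inj s s' : is_perm s -> ~~ is_id s -> is_perm s' -> ~~ is_id s' ->
  psi_q s = psi_q s' -> s = s'.
Proof.
(* A sandwiched and a non-sandwiched argument cannot share an image. Otherwise [s2] is
   [sandwich a.+1 tau b.-1], which is sandwiched if [b > 1]. If [b = 1], its smallest recoil would
   be [a + 1], but it starts with [1, ..., a + 1], so [a + 2] comes later. *)
have mixed s2 a tau b : is_perm s2 -> ~~ is_id s2 -> 1 <= b -> tau <> [::] ->
    (forall a b tau, 1 <= b -> tau <> [::] -> s2 <> sandwich a tau b) ->
    rho (a + b).+1 1 (sandwich a.+1 tau b.-1) = rho (smallest_recoil s2).+1 1 s2 -> False.
  move=> p2 nid2 b1 t0 ns e.
  have [[et] /esym e2] := rho1_inj e.
  have [b2|b2] := ltnP 1 b; first by apply: (ns a.+1 b.-1 tau) => //; slia.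
  have eb : b = 1 by slia.
  have [/andP[/andP[r1 r2] r3] _] := smallest_recoilP p2 nid2.
  move: r3; rewrite -et e2 eb addn1 /sandwich cats0 !index_cat !mem_iota.
  rewrite [X in if X then _ else _](_ : _ = false); last by slia.
  rewrite [X in _ < (if X then _ else _)](_ : _ = true); last by slia.
  have := index_mem a.+1 (iota 1 a.+1); rewrite mem_iota size_iota; slia.
move=> ps nid ps' nid'.
have [[a [tau [b [b1 t0 es _ ->]]]]|[ns ->]] := psi_qP ps nid;
have [[a' [tau' [b' [b1' t0' es' _ ->]]]]|[ns' ->]] := psi_qP ps' nid'.
- move=> /rho1_inj[[et] e].
  rewrite es in ps; rewrite es' in ps'.
  have [] := iota_prefix_inj (t := a + b) _ _ t0 t0' _ _ _ e.
  + slia.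
  + slia.
  + by move=> x; rewrite (mem_sandwich _ ps); slia.
  + by move=> x; rewrite (mem_sandwich _ ps') et; slia.
  + by rewrite !size_iota; slia.
  by move=> [ea] eta _; rewrite es es' ea eta; congr sandwich; slia.
- by move=> /(mixed _ _ _ _ ps' nid' b1 t0 ns').
- by move=> /esym/(mixed _ _ _ _ ps nid b1' t0' ns).
by move=> /rho1_inj[].
Qed.

(** The shape of the image gives [x = y]. Outside [opQ], the inserted value is then known (for [opS]
    it is the last entry of the image) and [rhoK] recovers the argument. *)
Lemma psi_inj (x y : op) s s' : dom x s -> dom y s' -> psi x s = psi y s' -> x = y /\ s = s'.
Proof.
move=> dx dy e; have s0 : psi x s <> [::].
  by move=> /(congr1 size); rewrite size_psi.
have exy : x = y.
  by apply: (op_shape_inj s0); [exact: psi_shape|rewrite e; exact: psi_shape].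
split=> //; have es : size s = size s'.
  by have := congr1 size e; rewrite !size_psi// => -[].
rewrite -{y}exy in dy e *; case: x dx dy e {s0} => /=.
- by move=> _ _ /rho1_inj[].
- by move=> [/evil_avoidingP[ps _] nid] [/evil_avoidingP[ps' _] nid']; apply: psi_q_inj.
- by move=> _ _; rewrite -es => e; rewrite -(rhoK 1 (size s).+1 s) e rhoK.
- move=> _ _; case: s s' es => [|u s] [|u' s'] // es; rewrite /psi_s => e.
  have el : (last 0 (u :: s)).+1 = (last 0 (u' :: s')).+1.
    by have := congr1 (last 0) e; rewrite !rho_rcons !last_rcons.
  by rewrite -(rhoK (last 0 (u :: s)).+1 (size (u :: s)).+1 (u :: s)) e el rhoK.
Qed.

(** * Predecessors under [opP], [opR] and [opS] *)

Definition has_pred s := exists (x : op) s', dom x s' /\ psi x s' = s.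

Lemma rho_id s : is_id s -> rho (size s).+1 (size s).+1 s = iota 1 (size s).+1.
Proof.
move=> /eqP ids; rewrite rho_rcons [X in map _ X]ids map_id_in.
  by rewrite iota1S.
by move=> x; rewrite mem_iota; case: (leqP (size s).+1 x); slia.
Qed.

Lemma del_last_id n : del n.+1 (iota 1 n.+1) = iota 1 n.
Proof.
rewrite -(rhoK n.+1 n.+1 (iota 1 n)).
by have := @rho_id (iota 1 n); rewrite /is_id size_iota eqxx => ->.
Qed.

Lemma has_pred_id n : evil_avoiding (iota 1 n.+1) -> has_pred (iota 1 n.+1).
Proof.
move=> ev; exists opS, (iota 1 n).
have idn : is_id (iota 1 n) by rewrite /is_id size_iota.
split; first (split; last by left).
  (* The shorter identity inherits avoidance as a deletion from the longer one. *)
  by rewrite -(del_last_id n); apply: evil_avoiding_del => //; rewrite mem_iota; slia.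
case: n idn {ev} => [//|n idn]; rewrite [LHS]/(rho (last 0 _).+1 _ _) last_iota.
by have := rho_id idn; rewrite size_iota.
Qed.

Lemma has_pred_head1 s : evil_avoiding s -> ~~ is_id s -> head 0 s = 1 -> has_pred s.
Proof.
case: s => // x s ev nid /= x1; move: ev nid; rewrite {}x1 => ev nid.
have [/is_permP[us _] _] := (evil_avoidingP _).1 ev.
have e : rho 1 1 (del 1 (1 :: s)) = 1 :: s := @rho_del 1 [::] s us.
exists opP, (del 1 (1 :: s)); split=> //=; split.
  by apply: evil_avoiding_del => //; rewrite mem_head.
apply: contra nid => /eqP ids; rewrite -e ids /is_id size_rho size_iota rho1 /=.
rewrite -[iota 2 _]/(iota (1 + 1) _) iotaDl; apply/eqP; congr (_ :: _).
by apply/eq_in_map => y; rewrite mem_iota /= => /andP[-> _].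
Qed.

Lemma size_del_rcons v l : uniq (rcons l v) -> size (del v (rcons l v)) = size l.
Proof.
move=> us; have := @rho_del v l [::]; rewrite cats1 => /(_ us) /(congr1 size).
by rewrite size_rho size_rcons => -[].
Qed.

Lemma rho_del_rcons v l : uniq (rcons l v) ->
  rho v (size (del v (rcons l v))).+1 (del v (rcons l v)) = rcons l v.
Proof. by move=> us; rewrite size_del_rcons// -cats1 rho_del// cats1. Qed.

Lemma has_pred_last1 s : evil_avoiding s -> head 0 s <> 1 -> last 0 s = 1 -> has_pred s.
Proof.
case/lastP: s => // l x ev h; rewrite last_rcons => x1; move: ev h; rewrite {}x1 => ev h.
have [/is_permP[us _] _] := (evil_avoidingP _).1 ev.
exists opR, (del 1 (rcons l 1)); split; last exact: rho_del_rcons.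
split; first by apply: evil_avoiding_del => //; rewrite mem_rcons mem_head.
by rewrite size_del_rcons//; case: l h {ev us}.
Qed.

(** The last entry is not [1], so the final run has length at least 2. Deleting its last entry
    leaves a nonempty run, whose end tells [psi_s] which value to restore. *)
Lemma has_pred_ends1 s : evil_avoiding s -> last 0 s <> 1 -> ends1 s -> has_pred s.
Proof.
move=> ev l1 /ends1P[l [[|[|t]] [// _ e]]]; first by case: l1; rewrite e last_cat.
have {}e : s = rcons (l ++ iota 1 t.+1) t.+2.
  by rewrite e iota1S -rcons_cat.
rewrite {}e {l1} in ev *; set v := t.+2.
have [/is_permP[us _] _] := (evil_avoidingP _).1 ev.
have eqd : del v (rcons (l ++ iota 1 t.+1) v) =
    map (fun x => if v < x then x.-1 else x) [seq x <- l | x != v] ++ iota 1 t.+1.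
  rewrite /del filter_rcons eqxx filter_cat map_cat; congr (_ ++ _).
  have /all_filterP -> : all (fun x => x != v) (iota 1 t.+1).
    by apply/allP => x; rewrite mem_iota /v; slia.
  by apply: map_id_in => x; rewrite mem_iota /v; case: (ltnP t.+2 x); slia.
have evd : evil_avoiding (del v (rcons (l ++ iota 1 t.+1) v)).
  by apply: evil_avoiding_del => //; rewrite mem_rcons mem_head.
exists opS, (del v (rcons (l ++ iota 1 t.+1) v)); split.
  split=> //; right; exists t.+1; rewrite eqd size_cat size_iota addnK drop_size_cat//.
  by split=> //; split=> //; slia.
have ld : last 0 (del v (rcons (l ++ iota 1 t.+1) v)) = t.+1.
  by rewrite eqd last_cat; exact: (last_iota t.+1).
have := rho_del_rcons us; rewrite /= /psi_s ld.
by case: (del _ _) ld.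
Qed.

(** * Avoidance and predecessors for sandwiched permutations *)

(** This turns occurrences of patterns into inequalities between positions. For the converse, a list
    with increasing positions is the filter of [s] by its own entries. *)
Lemma subseq_index s l : uniq s ->
  subseq l s = all [in s] l && sorted (fun x y => index x s < index y s) l.
Proof.
move=> us; pose lt x y := index x s < index y s.
have lttr : transitive lt by move=> y x z; rewrite /lt; slia.
have lts : sorted lt s.
  by apply/(sortedP 0) => i ilt; rewrite /lt !index_uniq// ltnW.
apply/idP/andP => [sub|[/allP ls ltl]].
  by split; [apply/allP/mem_subseq|apply: subseq_sorted sub lts].
suff -> : l = [seq x <- s | x \in l] by apply: filter_subseq.
apply: (irr_sorted_eq lttr) => //; first by move=> x; rewrite /lt ltnn.
  exact: sorted_filter.
by move=> x; rewrite mem_filter andb_idr// => /ls.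
Qed.

Lemma index_sandwich a b tau x : is_perm (sandwich a tau b) -> x \in sandwich a tau b ->
  (a + b < x) = (a <= index x (sandwich a tau b) < a + size tau).
Proof.
move=> ps xs; have mt := mem_sandwich x ps.
have [_ /(_ x)] := (is_permP _).1 ps; rewrite xs size_sandwich => /esym xb.
rewrite /sandwich !index_cat mem_iota mt !size_iota.
have ia := index_mem x (iota 1 a); have it := index_mem x tau.
rewrite !mem_iota size_iota mt in ia it; move: ia it.
case: (ltnP x (1 + a)) => xa; first by rewrite (_ : 1 <= x) /=; slia.
rewrite andbF; case: (boolP (_ < _ <= _)) => /=; slia.
Qed.

Lemma filter_sandwich a b tau (P : pred nat) : 
  (forall x, 1 <= x <= a + b -> ~~ P x) -> all P tau ->
  [seq x <- sandwich a tau b | P x] = tau.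
Proof.
move=> nP /all_filterP Pt; rewrite /sandwich !filter_cat Pt.
have f0 i n : 1 <= i -> i + n <= (a + b).+1 -> [seq x <- iota i n | P x] = [::].
  move=> i1 ib; apply/eqP; rewrite -[_ == _]negbK -has_filter; apply/hasPn => x.
  by rewrite mem_iota => xi; apply: nP; slia.
by rewrite !f0 ?cats0//; slia.
Qed.

(* An entry of [iota 1 a] or [iota a.+1 b] can play no role in a pattern: the top
   of a descent is in [tau], and so is every entry between two entries of [tau]. *)
Lemma evil_avoiding_sandwich a b tau : is_perm (sandwich a tau b) ->
  (forall w x y z, subseq [:: w; x; y; z] tau -> ~~ evil w x y z) ->
  evil_avoiding (sandwich a tau b).
Proof.
move=> ps ev; apply/evil_avoidingP; split=> // w x y z sub.
have [us ms] := (is_permP _).1 ps.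
have := sub; rewrite subseq_index//= !andbT => /andP[/and4P[ws xs ys zs]].
move=> /and3P[wx xy yz].
have desc u u' : u \in sandwich a tau b -> u' \in sandwich a tau b ->
    index u (sandwich a tau b) < index u' (sandwich a tau b) -> u' < u -> a + b < u.
  move=> uS uS' ii uu; rewrite ltnNge; apply/negP => uT.
  have : subseq [:: u; u'] [seq x <- sandwich a tau b | x <= a + b].
    by rewrite subseq_filter subseq_index//= uS uS' ii; slia.
  have -> : [seq x <- sandwich a tau b | x <= a + b] = iota 1 (a + b).
    rewrite /sandwich !filter_cat iotaD add1n; congr (_ ++ _).
      by apply/all_filterP/allP => i; rewrite mem_iota; slia.
    have /eqP -> : [seq x <- tau | x <= a + b] == [::].
      rewrite -[_ == _]negbK -has_filter; apply/hasPn => i.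
      by rewrite (mem_sandwich _ ps); slia.
    by apply/all_filterP/allP => i; rewrite mem_iota; slia.
  move=> /(subseq_sorted ltn_trans)/(_ (iota_ltn_sorted _ _)) /=; slia.
have dwx := desc _ _ ws xs wx; have dwy := desc _ _ ws ys (ltn_trans wx xy).
have dwz := desc _ _ ws zs (ltn_trans wx (ltn_trans xy yz)).
have dxy := desc _ _ xs ys xy; have dxz := desc _ _ xs zs (ltn_trans xy yz).
have dyz := desc _ _ ys zs yz.
have iw := index_sandwich ps ws; have ix := index_sandwich ps xs.
have iy := index_sandwich ps ys; have iz := index_sandwich ps zs.
apply/negP => e; suff [Tw Tx Ty Tz] : [/\ a + b < w, a + b < x, a + b < y & a + b < z].
  suff /ev : subseq [:: w; x; y; z] tau by rewrite e.
  rewrite -(@filter_sandwich a b tau (fun x => a + b < x)).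
  - by rewrite subseq_filter sub /= Tw Tx Ty Tz.
  - by move=> i; slia.
  - by apply/allP => i; rewrite (mem_sandwich _ ps) => /andP[].
(* In each pattern the entries that are not tops of descents are the minimum, which sits between two
   entries of [tau], and the last entry, which exceeds an entry of [tau]. *)
by move: e; rewrite /evil => e; split; slia.
Qed.

(** The predecessor has [a + 1] moved back to the last block. It avoids the patterns because [tau]
    is a factor of an evil-avoiding permutation. *)
Lemma has_pred_sandwich a b tau : evil_avoiding (sandwich a.+1 tau b) -> tau <> [::] ->
  has_pred (rho (a + b.+1).+1 1 (sandwich a.+1 tau b)).
Proof.
move=> /evil_avoidingP[ps ev] t0.
have ps' : is_perm (sandwich a tau b.+1).
  have pe : perm_eq (sandwich a tau b.+1) (sandwich a.+1 tau b).
    by rewrite /sandwich iota1S cat_rcons perm_cat2l (perm_catCA tau [:: a.+1]).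
  move: ps; rewrite /is_perm !size_sandwich.
  by rewrite (_ : a + size tau + b.+1 = a.+1 + size tau + b); [apply: perm_trans pe|slia].
(* An identity ends with its size, here larger than the last entry [a + b + 1] because [tau] is
   nonempty. *)
have nid : ~~ is_id (sandwich a tau b.+1).
  apply/negP => /eqP /(congr1 (last 0)); rewrite last_iota size_sandwich.
  rewrite /sandwich !last_cat -(addn1 b) iotaD last_cat /=.
  by case: tau t0 {ps ev ps'} => //= *; slia.
exists opQ, (sandwich a tau b.+1); split; last exact: psi_q_sandwich.
split=> //; apply: evil_avoiding_sandwich => // w x y z sub; apply: ev.
apply: subseq_trans sub _; rewrite /sandwich.
exact: subseq_trans (prefix_subseq _ _) (suffix_subseq _ _).
Qed.

(** * Predecessors under [opQ] *)

Lemma downclosed_iota s k : sorted ltn s -> k \in s ->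
  (forall x, x \in s -> 1 <= x) ->
  (forall x y, y \in s -> 1 <= x < y -> x \in s) -> exists n, s = iota 1 n.
Proof.
move=> ss ks pos down.
have bd x : x \in s -> x <= \max_(y <- s) y by move=> xs; apply: leq_bigmax_seq.
case: (ex_maxnP (ex_intro _ k ks) bd) => n ns nmax; exists n.
apply: (irr_sorted_eq ltn_trans ltnn) => //; first exact: iota_ltn_sorted.
move=> x; rewrite mem_iota; apply/idP/idP => [xs|xn].
  by have := pos _ xs; have := nmax _ xs; slia.
by have [->//|ne] := eqVneq x n; apply: (down _ n) => //; slia.
Qed.

(** If [1] came before [y], then [v, 1, y, x] would be a 4132. So [y] precedes [1], and the entries
    from [1] on are below [y], increasing and closed downwards, hence form [1, ..., n]. *)
Lemma ends1_inversion v r x y : evil_avoiding (v :: r) ->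
  1 <= x -> x < y -> y < v -> index y r < index x r -> ends1 (v :: r).
Proof.
move=> ev x1 xy yv ii; have [/is_permP[us ms] evs] := (evil_avoidingP _).1 ev.
have /andP[vr ur] : (v \notin r) && uniq r := us.
have vs : 1 <= v <= size (v :: r) by rewrite -ms mem_head.
have mr z : 1 <= z < v -> z \in r.
  move=> zv; have : z \in v :: r by rewrite ms; slia.
  by rewrite inE; case: eqVneq => //= e; slia.
have evr w1 w2 w3 : subseq [:: w1; w2; w3] r -> ~~ evil v w1 w2 w3.
  by move=> sub; apply: evs; rewrite /= eqxx.
have y1 : index y r < index 1 r.
  rewrite ltnNge; apply/negP => i1.
  have [e|x1'] := eqVneq x 1; first by rewrite e in ii; slia.
  have ne : index 1 r != index y r.
    apply/eqP => e; have := nth_index 0 (mr 1 ltac:(slia)).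
    by rewrite e nth_index ?mr; slia.
  suff /evr : subseq [:: 1; y; x] r by rewrite /evil; slia.
  by rewrite subseq_index//= !mr; slia.
have r1 : 1 \in r by apply: mr; slia.
have [l1 [l2 er]] : exists l1 l2, r = l1 ++ 1 :: l2.
  by case/splitPr: r1 => l1 l2; exists l1, l2.
have yl1 : y \in l1.
  move: y1; rewrite er !index_cat /= ?eqxx ?addn0; case: (y \in l1) => //.
  by have := index_size 1 l1; case: (1 \in l1); slia.
have := ur; rewrite er cat_uniq => /and3P[_ /hasPn l12 /andP[l21 ul2]].
have evl u z : u \in l1 -> z \in l2 -> ~~ evil v u 1 z.
  move=> ul zl; apply: evr; rewrite er -[[:: u; 1; z]]/([:: u] ++ [:: 1; z]).
  by apply: cat_subseq; rewrite ?sub1seq//= sub1seq.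
have l2r z : z \in l2 -> [/\ 1 < z, z != v & z \notin l1].
  move=> zl; have zr : z \in r by rewrite er mem_cat inE zl !orbT.
  split; last by apply: l12; rewrite inE zl orbT.
    have := ms z; rewrite inE zr orbT => /esym/andP[z1 _].
    have : z != 1 by apply: contraNneq l21 => <-.
    slia.
  by apply: contraNneq vr => <-.
(* A larger [z] would make [v, y, 1, z] a 4213 or a 3214. *)
have l2y z : z \in l2 -> z < y.
  move=> zl; have [z1 zv zl1] := l2r z zl; have := evl _ _ yl1 zl.
  have zy : z != y by apply: contraNneq zl1 => ->.
  rewrite /evil; slia.
have pos z : z \in 1 :: l2 -> 1 <= z.
  by rewrite inE => /predU1P[->//|/l2r[]]; slia.
have [n e1] : exists n, 1 :: l2 = iota 1 n.
  apply: (@downclosed_iota _ 1); rewrite ?mem_head//.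
    rewrite /= path_sortedE; last exact: ltn_trans.
    apply/andP; split; first by apply/allP => z /l2r[].
    apply/(sortedP 0) => i il.
    have zi := mem_nth 0 (ltnW il); have zj := mem_nth 0 il.
    (* A descent after [1] would give a 4132 with [v] and [1]. *)
    have /evr : subseq [:: 1; nth 0 l2 i; nth 0 l2 i.+1] r.
      rewrite er; apply: subseq_trans (suffix_subseq _ _); rewrite /= ?eqxx.
      by rewrite subseq_index//= zi zj !index_uniq ?(ltnW il) ?ltnSn.
    have ne : nth 0 l2 i != nth 0 l2 i.+1.
      by rewrite nth_uniq ?(ltnW il)// neq_ltn ltnSn.
    have := l2y _ zi; have := l2y _ zj; have := l2r _ zj => -[].
    rewrite /evil; slia.
  move=> w z; rewrite inE => /predU1P[->|zl]; first by slia.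
  move=> wz; have zy := l2y _ zl; have : w \in r by apply: mr; slia.
  rewrite er mem_cat => /orP[wl1|//].
  (* A smaller [w] left before [1] would make [v, w, 1, z] a 4213. *)
  have := evl _ _ wl1 zl; have [_ _ /negP zl1] := l2r _ zl.
  by have [e|] := eqVneq w 1; [rewrite e mem_head|rewrite /evil; slia].
apply/ends1P; exists (v :: l1), n; split; last by rewrite e1.
by case: n e1.
Qed.

Lemma has_pred_head s : evil_avoiding s -> s <> [::] -> head 0 s <> 1 -> ~~ ends1 s ->
  has_pred s.
Proof.
case: s => // v r ev _ /= v1 ne.
have [psv _] := (evil_avoidingP _).1 ev; have [us ms] := (is_permP _).1 psv.
have {}v1 : 1 < v by have := ms v; rewrite mem_head; slia.
pose d := del v (v :: r).
have evd : evil_avoiding d by apply: evil_avoiding_del; rewrite ?mem_head.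
have [pd _] := (evil_avoidingP _).1 evd; have [ud md] := (is_permP _).1 pd.
have es : v :: r = rho v 1 d by rewrite (@rho_del v [::]).
pose f x := if v <= x then x.+1 else x.
have er : r = map f d by move: es; rewrite rho1 => -[].
have finj : injective f.
  by move=> x y; rewrite /f; case: (leqP v x); case: (leqP v y); slia.
have idf x : index (f x) r = index x d by rewrite er index_map.
have fs x : x < v -> f x = x by rewrite /f ltnNge => /negbTE ->.
have fi k : k < v -> map f (iota 1 k) = iota 1 k.
  by move=> kv; apply: map_id_in => x; rewrite mem_iota => xk; apply: fs; slia.
have ends_d l t : 1 <= t < v -> d <> l ++ iota 1 t.
  move=> /andP[t1 tv] ed; case/negP: ne; apply/ends1P; exists (v :: map f l), t.
  by rewrite er ed map_cat fi.
(* By [ends1_inversion], the values below [v] occur in increasing order. *)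
have mono x y : 1 <= x -> x < y -> y < v -> y \in d -> index x d < index y d.
  move=> x1 xy yv yd; rewrite ltn_neqAle leqNgt; apply/andP; split.
    apply/eqP => e; have := nth_index 0 yd; rewrite -e nth_index; first by slia.
    by move: yd; rewrite !md; slia.
  apply: contra ne; rewrite -!idf !fs; try slia.
  exact: ends1_inversion.
have nrec i : i < v.-1 -> ~~ is_recoil d i.
  move=> iv; rewrite /is_recoil negb_and -leqNgt -implybE; apply/implyP => id_.
  by apply/ltnW/mono; rewrite ?md; slia.
(* If [v] were the largest entry, [d] would be an identity and [v :: r] would end with it. *)
have vd : v <= size d.
  rewrite leqNgt; apply/negP => dv.
  have : d = [::] ++ iota 1 (size d).
    rewrite /= -(filter_le_iota pd (leqnn _)) => [|i id_]; last by apply: nrec; slia.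
    by apply/esym/all_filterP/allP => x; rewrite md => /andP[].
  apply: ends_d; have := ms v; rewrite mem_head er /= size_map; slia.
have v1d : v.-1 \in d by rewrite md; slia.
have vd' : v \in d by rewrite md; slia.
have nev : index v d <> index v.-1 d.
  by move=> e; have := nth_index 0 vd'; rewrite e nth_index//; slia.
(* If [v] precedes [v - 1] in [d], the smallest recoil of [d] is [v - 1], so [psi_q] puts [v] back
   in front unless [d] is sandwiched. *)
have [lt|] := ltnP (index v d) (index v.-1 d).
  have fr : first_recoil d v.-1.
    by split=> //; rewrite /is_recoil prednK; slia.
  have nid : ~~ is_id d.
    apply/negP => /eqP ed; move: lt.
    have ix x : 1 <= x <= size d -> index x d = x.-1.
      move=> xd; rewrite ed -[X in index X](_ : nth 0 (iota 1 (size d)) x.-1 = x).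
        by rewrite index_uniq ?iota_uniq ?size_iota; slia.
      by rewrite nth_iota; slia.
    by rewrite !ix; slia.
  have [[a [tau [b [b1 t0 ed et _]]]]|[_ eq]] := psi_qP pd nid; last first.
    exists opQ, d; split=> //=.
    by rewrite eq (smallest_recoilE fr) prednK; [rewrite es|slia].
  rewrite (smallest_recoilE fr) in et.
  (* With [a = 0], [d] would end with [1, ..., b]; with a nonempty first block, the predecessor is
     the rearranged sandwich. *)
  case: a ed et => [|a] ed et; first by have [] := ends_d tau b ltac:(slia) ed.
  rewrite es (_ : v = (a + b.+1).+1); last by slia.
  by rewrite ed; apply: has_pred_sandwich; rewrite -?ed.
move=> le; have {nev}lt : index v.-1 d < index v d by slia.
set j := index v.-1 d in lt.
(* An entry [x > v] before [v - 1] would give [v, x + 1, v - 1, v + 1] in [v :: r], a 2413. So [d]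
   starts with [1, ..., v - 1]. *)
have big x : v < x -> x \in d -> j < index x d.
  move=> vx xd; rewrite ltnNge; apply/negP => xj.
  have nej : index x d != j.
    by apply/eqP => e; have := nth_index 0 xd; rewrite e nth_index//; slia.
  have : subseq [:: x; v.-1; v] d.
    by rewrite subseq_index//= xd v1d vd' /=; slia.
  move=> /(map_subseq f); rewrite -er /= => sub.
  have := (evil_avoidingP _).1 ev => -[_ /(_ v (f x) (f v.-1) (f v))].
  rewrite /= eqxx => /(_ sub); rewrite (fs v.-1); last by slia.
  by rewrite /f leqnn (ltnW vx) /evil; slia.
pose l1 := take j.+1 d; pose l2 := drop j.+1 d.
have ed : d = l1 ++ l2 by rewrite cat_take_drop.
have ml1 x : x \in d -> (x \in l1) = (x < v).
  move=> xd; rewrite /l1 in_take// ltnS; case: (ltngtP x v) => [xv|xv|->].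
  - have [->|xne] := eqVneq x v.-1; first exact: leqnn.
    by apply/ltnW/mono => //; move: xd; rewrite md; slia.
  - by have := big x xv xd; slia.
  - by slia.
have e1 : l1 = iota 1 v.-1.
  rewrite -(filter_le_iota pd _ nrec); last by slia.
  rewrite ed filter_cat.
  have /all_filterP -> : all (fun x => x <= v.-1) l1.
    by apply/allP => x xl; have := ml1 x (mem_take xl); rewrite xl; slia.
  have /eqP -> : [seq x <- l2 | x <= v.-1] == [::]; last by rewrite cats0.
  rewrite -[_ == _]negbK -has_filter; apply/hasPn => x xl.
  have := ml1 x (mem_drop xl); move: ud; rewrite ed cat_uniq => /and3P[_ /hasPn/(_ x xl) + _].
  by rewrite /= => /negbTE ->; slia.
have l20 : l2 <> [::].
  by move=> l20; move: vd; rewrite ed l20 cats0 e1 size_iota; slia.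
(* The last block is empty, so the predecessor is sandwiched with [b = 1] and its last entry is
   [v - 1]. *)
have {}ed : d = sandwich (v - 2).+1 l2 0.
  by rewrite /sandwich cats0 {1}ed e1; congr (iota 1 _ ++ _); slia.
rewrite es (_ : v = (v - 2 + 1).+1); last by slia.
by rewrite ed; apply: has_pred_sandwich; rewrite -?ed.
Qed.

(** * Existence and uniqueness of the word *)

Lemma has_predP s : evil_avoiding s -> s <> [::] -> has_pred s.
Proof.
move=> ev s0; have [ids|nid] := boolP (is_id s).
  move: ev; rewrite (eqP ids); case: (size s) (size_eq0 s) => [|n _].
    by move=> /esym/eqP.
  exact: has_pred_id.
have [h|/eqP h] := eqVneq (head 0 s) 1; first exact: has_pred_head1.
have [la|/eqP la] := eqVneq (last 0 s) 1; first exact: has_pred_last1.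
by have [en|en] := boolP (ends1 s); [apply: has_pred_ends1|apply: has_pred_head].
Qed.

Lemma run_rcons w (x : op) : run (rcons w x) = psi x (run w).
Proof. by rewrite /run -cats1 foldl_cat. Qed.

Lemma chain_ok_rcons s w (x : op) :
  chain_ok s (rcons w x) <-> chain_ok s w /\ dom x (foldl (fun s o => psi o s) s w).
Proof. by elim: w s => [|y w IH] s /=; [tauto|rewrite IH; tauto]. Qed.

Lemma chain_exists s : evil_avoiding s -> exists w, chain_ok [::] w /\ run w = s.
Proof.
have [n sn] := ubnP (size s); elim: n s sn => // n IH s sn ev.
case: s ev sn => [|y s] ev sn; first by exists [::].
have [x [s' [dx e]]] : has_pred (y :: s) by apply: has_predP.
have [w [cw rw]] : exists w, chain_ok [::] w /\ run w = s'.
  (* Every domain consists of evil-avoiding permutations, so the induction on the size applies to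
     the predecessor. *)
  apply: IH; last by case: x dx {e} => /= -[].
  by move: sn; rewrite -e size_psi.
by exists (rcons w x); rewrite run_rcons rw chain_ok_rcons -/(run w) rw.
Qed.

Lemma chain_unique w w' : chain_ok [::] w -> chain_ok [::] w' -> run w = run w' -> w = w'.
Proof.
elim/last_ind: w w' => [|w x IH]; case/lastP=> [|w' x'] //.
- by move=> _ /chain_ok_rcons[_ dx] /(congr1 size); rewrite run_rcons size_psi.
- by move=> /chain_ok_rcons[_ dx] _ /(congr1 size); rewrite run_rcons size_psi.
move=> /chain_ok_rcons[cw dx] /chain_ok_rcons[cw' dx']; rewrite !run_rcons => e.
by have [-> /IH ->] := psi_inj dx dx' e.
Qed.

Theorem theorem5p15 (pi : seq nat) :
  evil_avoiding pi ->
  exists! w : seq op, chain_ok [::] w /\ run w = pi.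
Proof.
move=> /chain_exists[w [cw rw]]; exists w; split=> // w' [cw' rw'].
by apply: chain_unique => //; rewrite rw.
Qed.
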